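(* Let $\mathfrak A^{(0)}_{-1}(q;t):=\mathrm{tr}_{\mathcal F^{-1}_{(0)}}\big(q^{L_0}\mathsf A(t)\big)$. Then $$\mathfrak A^{(0)}_{-1}(q;t)=\frac{{}_2\Phi_1(0,0;q;q)}{t^{-1/2}-t^{1/2}}+t^{1/2}\sum_{i=1}^\infty\frac{q^{i-1}}{(q)_{i-1}(q)_{i-1}}\big({}_3\Phi_2(0,0,q;tq^i,q^i;q)-1\big) -t^{-1/2}\sum_{i=1}^\infty\frac{q^{i-1}}{(q)_{i-1}(q)_{i-1}}\big({}_3\Phi_2(0,0,q;t^{-1}q^i,q^i;q)-1\big).$$
   Context: Let $\mathcal F^{-1}$ be the bosonic Fock space generated from a vacuum $|0\rangle$ by commuting creation operators $\gamma^+_{-r},\gamma^-_{-r}$, $r\in\frac12+\mathbb Z_{\ge0}$ (with $[\gamma^+_r,\gamma^-_s]=\delta_{r+s,0}$, all other brackets zero, $\gamma^\pm_r|0\rangle=0$ for $r>0$). It has basis $v=\gamma^+_{-r_1}\cdots\gamma^+_{-r_a}\gamma^-_{-s_1}\cdots\gamma^-_{-s_b}|0\rangle$ with $r_1\ge\cdots\ge r_a>0$, $s_1\ge\cdots\ge s_b>0$ in $\frac12+\mathbb Z$. $L_0$ acts on $v$ by $\sum_i r_i+\sum_j s_j$. $\mathcal F^{-1}_{(m)}$ is the span of basis vectors with $a-b=m$. The operator $\mathsf A(t)=-\sum_{r\in\frac12+\mathbb Z}t^r\gamma^+_{-r}\gamma^-_r$ acts diagonally: $\mathsf A(t)v=\big(\sum_{i}t^{r_i}-\sum_j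 t^{-s_j}+\frac{1}{t^{-1/2}-t^{1/2}}\big)v$. Notation: $(a)_n=(1-a)\cdots(1-aq^{n-1})$, $(a)_0=1$, $(a)_\infty=\prod_{i\ge0}(1-aq^i)$, and ${}_r\Phi_s(a_1,\dots,a_r;b_1,\dots,b_s;z)=\sum_{n\ge0}\frac{(a_1)_n\cdots(a_r)_n}{(b_1)_n\cdots(b_s)_n(q)_n}\big((-1)^nq^{n(n-1)/2}\big)^{1+s-r}z^n$. *)

(* Defs.v *)
From HB Require Import structures.
From mathcomp Require Import all_boot all_order all_algebra.
Set Implicit Arguments. Unset Strict Implicit. Unset Printing Implicit Defensive.
Import Order.TTheory GRing.Theory Num.Theory.
Local Open Scope ring_scope.

(* Formal power series in q with coefficients in a field F,            *)
(* represented by their coefficient sequences.                         *)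
Definition ps (F : fieldType) := nat -> F.

Section PS.
Variable F : fieldType.
Implicit Types (f g : ps F) (c : F).

Definition ps_C c : ps F := fun n => if n == 0%N then c else 0.
Definition ps_one : ps F := ps_C 1.
Definition ps_zero : ps F := ps_C 0.
Definition ps_Xn (k : nat) : ps F := fun n => if n == k then 1 else 0.
Definition ps_q : ps F := ps_Xn 1.
Definition ps_add f g : ps F := fun n => f n + g n.
Definition ps_sub f g : ps F := fun n => f n - g n.
Definition ps_scale c f : ps F := fun n => c * f n.
Definition ps_mul f g : ps F := fun n => \sum_(i < n.+1) f i * g (n - i)%N.
Definition ps_pow f (m : nat) : ps F := iter m (ps_mul f) ps_one.
Definition ps_prod (s : seq (ps F)) : ps F := foldr ps_mul ps_one s.
(* multiplicative inverse of a series with invertible constant term: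
   f = f0 (1 - h), h(0)=0, 1/f = f0^-1 * sum_m h^m *)
Definition ps_inv f : ps F := fun n =>
  \sum_(m < n.+1)
     (f 0%N)^-1 * ps_pow (ps_sub ps_one (ps_scale (f 0%N)^-1 f)) m n.
(* sum_{n>=0} T n of a q-adically convergent family in which the n-th
   term is O(q^n): the coefficient of q^N only involves n <= N. *)
Definition ps_sum (T : nat -> ps F) : ps F :=
  fun N => \sum_(n < N.+1) T n N.

Definition qpoch (a : ps F) (n : nat) : ps F :=
  ps_prod [seq ps_sub ps_one (ps_mul a (ps_Xn j)) | j <- iota 0 n].

(* basic hypergeometric series
   rPhis(a_1..a_r; b_1..b_s; z)
     = sum_n (a_1)_n..(a_r)_n / ((b_1)_n..(b_s)_n (q)_n)
             * ((-1)^n q^(n(n-1)/2))^(1+s-r) z^n ,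
   for r <= s+1 (so that the exponent 1+s-r is a natural number) and
   z with zero constant term (so the series converges q-adically). *)
Definition qPhi (as_ bs : seq (ps F)) (z : ps F) : ps F :=
  ps_sum (fun n =>
    ps_mul (ps_mul (ps_prod [seq qpoch a n | a <- as_])
                   (ps_inv (ps_mul (ps_prod [seq qpoch b n | b <- bs])
                                   (qpoch ps_q n))))
           (ps_mul (ps_pow (ps_scale ((-1) ^+ n) (ps_Xn ((n * (n - 1)) %/ 2)))
                           ((size bs).+1 - size as_))
                   (ps_pow z n))).

End PS.

(* The bosonic Fock space F^{-1}.  A basis vector                       *)
(*   gamma^+_{-r_1}..gamma^+_{-r_a} gamma^-_{-s_1}..gamma^-_{-s_b}|0>   *)
(* is encoded by its two multiplicity functions: mp k (resp. mm k) is   *)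
(* the number of factors gamma^+_{-(k+1/2)} (resp. gamma^-_{-(k+1/2)}). *)
(* A basis vector of L_0-eigenvalue N only involves modes k < N with    *)
(* multiplicities <= 2N, so the basis vectors of weight N are exactly   *)
(* the pairs of functions 'I_N -> 'I_(2N+1) of doubled weight 2N.       *)
(* We write x = t^{1/2}, so t^r = x^(2k+1) for r = k + 1/2.             *)
Section Fock.
Variable F : fieldType.
Variable N : nat.
Definition mult := {ffun 'I_N -> 'I_(2 * N).+1}.

Definition fock_count (m : mult) : nat := \sum_(k < N) (m k : nat).
(* twice the L_0 contribution: sum of 2r over the parts *)
Definition fock_dweight (m : mult) : nat := \sum_(k < N) (2 * k + 1) * m k.

Definition A_eigen (x : F) (mp mm : mult) : F :=
  \sum_(k < N) (mp k : nat)%:R * x ^+ (2 * k + 1)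
  - \sum_(k < N) (mm k : nat)%:R * x ^- (2 * k + 1)
  + (x^-1 - x)^-1.

Definition trace_A_coeff (x : F) : F :=
  \sum_(mp : mult) \sum_(mm : mult)
    (if (fock_count mp == fock_count mm)
        && (fock_dweight mp + fock_dweight mm == 2 * N)%N
     then A_eigen x mp mm else 0).
End Fock.

Definition trace_A (F : fieldType) (x : F) : ps F :=
  fun N => trace_A_coeff N x.

Definition theorem2p4_rhs (F : fieldType) (x : F) : ps F :=
  let t := x ^+ 2 in
  let Z := ps_zero F in
  let q := ps_q F in
  let inner (c : F) : ps F :=
    ps_sum (fun n =>
      let i := n.+1 in
      ps_mul (ps_mul (ps_Xn F (i - 1))
                     (ps_inv (ps_mul (qpoch q (i - 1)) (qpoch q (i - 1)))))
             (ps_sub (qPhi [:: Z; Z; q]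
                           [:: ps_scale c (ps_Xn F i); ps_Xn F i] q)
                     (ps_one F))) in
  ps_add (ps_add (ps_scale (x^-1 - x)^-1 (qPhi [:: Z; Z] [:: q] q))
                 (ps_scale x (inner t)))
         (ps_scale (- x^-1) (inner t^-1)).

(* Main.v *)
(* Group the basis vectors by the common number [a] of factors gamma^+ and    *)
(* gamma^-. Subtracting 1/2 from every index turns the factors of one sign    *)
(* into a partition lambda with [a] nonnegative parts, so both sides reduce   *)
(* to the series P_a(c) = sum_lambda q^|lambda| sum_i c^lambda_i. Marking the *)
(* multiplicity of a part value gives                                         *)
(*   P_a(c) = sum_(1 <= l <= a) 1 / ((1 - c q^l) (q)_(a-l)),                  *)
(* which is the trace, while marking the position of a part gives             *)
(*   P_a(c) = sum_(1 <= i <= a) 1 / ((q)_(i-1) (c q^i)_(a-i+1)),              *)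
(* which is the right-hand side with n = a - i + 1. The two expressions agree *)
(* because both satisfy (1 - c q^a) P_a = P_(a-1) + 1 / (q)_(a-1).            *)

Require Import Defs.
From HB Require Import structures.
From mathcomp Require Import all_boot all_order all_algebra.
From mathcomp Require Import boolp ring zify.
Import GRing.Theory.
Local Open Scope ring_scope.
Set Implicit Arguments. Unset Strict Implicit.
Unset Printing Implicit Defensive.

(** Write P_a for [part_gf] and t = x^2. Both sides are brought to one normal form, the sum over a
    of q^a / (q)_a times x P_a(t) - x^-1 P_a(t^-1) + (x^-1 - x)^-1 / (q)_a. On the trace side
    ([trace_A_coef]), q^a collects the 2a halves removed from the indices, and 1 / (q)_a counts the
    partitions of the sign that is not marked. On the hypergeometric side ([theorem2p4_rhs_coef]),
    the same factor arises from (q)_(i-1) (q^i)_n = (q)_a. The two forms of P_a meet in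
    [part_gf_multiplicity].

    The trace at weight N sees only N modes, so its series are truncated: [modes_gf_qbinomial] gives
    a Gaussian binomial, congruent to 1 / (q)_a modulo q^N. This suffices because the prefactor q^a
    leaves only coefficients up to N - a to compare. *)

(** * Formal power series as a commutative ring *)

Section PowerSeriesRing.
Variable F : fieldType.
Implicit Types (f g h : ps F) (c : F).

(** Truncating to polynomials lets the ring laws be inherited from [{poly F}]. *)
Lemma ps_mul_polyE f g m n : (n < m)%N ->
  ps_mul f g n = (\poly_(i < m) f i * \poly_(i < m) g i)`_n.
Proof.
move=> lt_nm; rewrite coefM; apply: eq_bigr => i _.
by rewrite !coef_poly !(leq_ltn_trans _ lt_nm) ?leq_subr // -ltnS.
Qed.

Lemma ps_mulC : commutative (@ps_mul F).
Proof.
by move=> f g; apply/funext => n; rewrite !(@ps_mul_polyE _ _ n.+1) // mulrC.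
Qed.

Lemma ps_mulA : associative (@ps_mul F).
Proof.
move=> f g h; apply/funext => n; pose P f := \poly_(i < n.+1) f i.
transitivity ((P f * (P g * P h))`_n).
  rewrite coefM; apply: eq_bigr => i _.
  by rewrite coef_poly ltn_ord (@ps_mul_polyE _ _ n.+1) // ltnS leq_subr.
rewrite mulrA coefM; apply: eq_bigr => i _.
by rewrite coef_poly ltnS leq_subr (@ps_mul_polyE _ _ n.+1).
Qed.

Lemma ps_mul1 : left_id (@ps_one F) (@ps_mul F).
Proof.
move=> f; apply/funext => n; rewrite /ps_mul big_ord_recl subn0 mul1r.
by rewrite big1 ?addr0 // => i _; rewrite mul0r.
Qed.

Lemma ps_mulDl : left_distributive (@ps_mul F) (@ps_add F).
Proof.
move=> f g h; apply/funext => n; rewrite /ps_mul /ps_add -big_split.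
by apply: eq_bigr => i _; rewrite mulrDl.
Qed.

Lemma ps_addA : associative (@ps_add F).
Proof. by move=> f g h; apply/funext => n; exact: addrA. Qed.

Lemma ps_addC : commutative (@ps_add F).
Proof. by move=> f g; apply/funext => n; exact: addrC. Qed.

Lemma ps_add0 : left_id (@ps_zero F) (@ps_add F).
Proof.
by move=> f; apply/funext => n; rewrite /ps_add /ps_zero /ps_C if_same add0r.
Qed.

Lemma ps_addN : left_inverse (@ps_zero F) (ps_sub (@ps_zero F)) (@ps_add F).
Proof.
move=> f; apply/funext => n.
by rewrite /ps_add /ps_sub /ps_zero /ps_C if_same sub0r addNr.
Qed.

End PowerSeriesRing.

HB.instance Definition _ (F : fieldType) := gen_eqMixin (ps F).
HB.instance Definition _ (F : fieldType) := gen_choiceMixin (ps F).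
HB.instance Definition _ (F : fieldType) := GRing.isZmodule.Build (ps F)
  (@ps_addA F) (@ps_addC F) (@ps_add0 F) (@ps_addN F).

Lemma ps_one_neq0 (F : fieldType) : ps_one F != 0.
Proof.
apply/eqP => /(congr1 (fun f : ps F => f 0%N)) /eqP.
by rewrite /ps_one /ps_zero /ps_C /= oner_eq0.
Qed.
HB.instance Definition _ (F : fieldType) :=
  GRing.Zmodule_isComNzRing.Build (ps F)
    (@ps_mulA F) (@ps_mulC F) (@ps_mul1 F) (@ps_mulDl F) (@ps_one_neq0 F).

(** * Coefficients and inverses of power series *)

Section PowerSeriesCoefficients.
Variable F : fieldType.
Implicit Types (f g h : ps F) (c : F) (i j k m n : nat).

Lemma ps_addE f g n : (f + g) n = f n + g n. Proof. by []. Qed.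

Lemma ps_oppE f n : (- f) n = - f n.
Proof.
rewrite [LHS]/(ps_zero F n - f n) /ps_zero /ps_C if_same; exact: sub0r.
Qed.

Lemma ps_zeroE n : (0 : ps F) n = 0.
Proof. by rewrite [LHS]/(ps_zero F n) /ps_zero /ps_C if_same. Qed.

Lemma ps_mulE f g n : (f * g) n = \sum_(i < n.+1) f i * g (n - i)%N.
Proof. by []. Qed.

Lemma ps_sum_coefE (I : Type) (r : seq I) (P : pred I) (G : I -> ps F) n :
  (\sum_(i <- r | P i) G i) n = \sum_(i <- r | P i) G i n.
Proof.
by apply: (big_morph (fun f : ps F => f n)) => [f g|]; rewrite ?ps_zeroE.
Qed.

Lemma ps_subE f g : ps_sub f g = f - g.
Proof. by apply/funext => n; rewrite ps_addE ps_oppE. Qed.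

Lemma ps_C_zmod_morphism : zmod_morphism (@ps_C F).
Proof.
move=> c d; apply/funext => n; rewrite ps_addE ps_oppE /ps_C.
by case: eqP; rewrite ?subr0.
Qed.

Lemma ps_scaleE c f : ps_scale c f = ps_C c * f.
Proof.
apply/funext => n; rewrite ps_mulE big_ord_recl subn0 /ps_C /=.
by rewrite big1 ?addr0 // => i _; rewrite mul0r.
Qed.

Lemma ps_C_monoid_morphism : monoid_morphism (@ps_C F).
Proof.
split=> // c d; apply/funext => n; rewrite -ps_scaleE /ps_scale /ps_C.
by case: eqP; rewrite ?mulr0.
Qed.

HB.instance Definition _ := GRing.isZmodMorphism.Build F (ps F) (@ps_C F)
  ps_C_zmod_morphism.
HB.instance Definition _ := GRing.isMonoidMorphism.Build F (ps F) (@ps_C F)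
  ps_C_monoid_morphism.

Lemma ps_powE f m : ps_pow f m = f ^+ m.
Proof. by elim: m => [|m IHm]; rewrite ?expr0 // exprS -IHm. Qed.

Lemma ps_XnE k : ps_Xn F k = ps_q F ^+ k.
Proof.
elim: k => [|k IHk]; apply/funext => n; first by [].
rewrite exprS -IHk ps_mulE /ps_q /ps_Xn; case: n => [|n].
  by rewrite big_ord1 mul0r.
rewrite (bigD1 (inord 1)) //= inordK // eqxx mul1r subSS subn0 big1 ?addr0 //.
by move=> i; rewrite -val_eqE /= inordK // => /negPf->; rewrite mul0r.
Qed.

Lemma ps_mulXn k f n :
  (ps_q F ^+ k * f) n = if (n < k)%N then 0 else f (n - k)%N.
Proof.
rewrite -ps_XnE ps_mulE /ps_Xn; case: ltnP => [lt_nk | le_kn].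
  rewrite big1 // => i _; rewrite ltn_eqF ?mul0r //.
  exact: leq_trans (ltn_ord i) _.
rewrite (bigD1 (inord k)) //= inordK ?ltnS // eqxx mul1r big1 ?addr0 // => i.
by rewrite -val_eqE /= inordK ?ltnS // => /negPf->; rewrite mul0r.
Qed.

Lemma ps_expr_coef_lt h m n : h 0%N = 0 -> (n < m)%N -> (h ^+ m) n = 0.
Proof.
move=> h0; elim: m n => // m IHm n; rewrite ltnS => le_nm.
rewrite exprS ps_mulE big1 // => -[[|i] /= lt_in] _; first by rewrite h0 mul0r.
rewrite IHm ?mulr0 //; case: n le_nm lt_in => // n le_nm lt_in.
by rewrite subSS (leq_ltn_trans (leq_subr _ _)).
Qed.

(** The length of the sum in [ps_inv] depends on the coefficient. Since h^i is O(q^i), one length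
    [m] serves all coefficients below [m]. *)
Lemma ps_inv_coefE f m n : f 0%N != 0 -> (n < m)%N ->
  ps_inv f n =
  (ps_C (f 0%N)^-1 * \sum_(i < m) (1 - ps_C (f 0%N)^-1 * f) ^+ i) n.
Proof.
move=> f0 lt_nm; set h := 1 - _ * f.
have h0 : h 0%N = 0.
  by rewrite /h ps_addE ps_oppE -ps_scaleE /ps_scale mulVf ?subrr.
rewrite -ps_scaleE /ps_scale ps_sum_coefE /ps_inv -mulr_sumr; congr (_ * _).
rewrite ps_scaleE ps_subE (big_ord_widen m (fun i => ps_pow h i n)) //.
rewrite [RHS](bigID (fun i : 'I_m => (i < n.+1)%N)) /= [X in _ + X]big1 ?addr0.
  by apply: eq_bigr => i _; rewrite ps_powE.
by move=> i; rewrite -leqNgt => lt_ni; rewrite ps_expr_coef_lt.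
Qed.

Definition ps_unit f := f 0%N != 0.
(** The unit-ring interface demands that inversion fix non-units. *)
Definition ps_invr f := if ps_unit f then ps_inv f else f.

Lemma ps_mulVf : {in ps_unit, left_inverse 1 ps_invr *%R}.
Proof.
move=> f f0; rewrite /ps_invr [ps_unit f]f0; apply/funext => n.
set c := f 0%N; set h : ps F := 1 - ps_C c^-1 * f.
have h0 : h 0%N = 0.
  by rewrite /h ps_addE ps_oppE -ps_scaleE /ps_scale mulVf ?subrr.
transitivity ((ps_C c^-1 * (\sum_(i < n.+1) h ^+ i) * f) n).
  rewrite !ps_mulE; apply: eq_bigr => i _; congr (_ * _).
  exact: ps_inv_coefE.
(* As [f] divided by its constant term is 1 - h, the geometric sum telescopes. *)
have -> : ps_C c^-1 * (\sum_(i < n.+1) h ^+ i) * f = 1 - h ^+ n.+1.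
  rewrite -[RHS]opprB subrX1 -mulNr opprB /h subKr mulrAC; ring.
by rewrite ps_addE ps_oppE ps_expr_coef_lt // subr0.
Qed.

Lemma ps_unitP f g : g * f = 1 -> ps_unit f.
Proof.
move/(congr1 (fun u : ps F => u 0%N)) => /eqP.
rewrite ps_mulE big_ord1 /= => /eqP gf1; apply/eqP => f0.
by move: gf1; rewrite f0 mulr0 => /esym/eqP; rewrite oner_eq0.
Qed.

Lemma ps_invr_out : {in [predC ps_unit], ps_invr =1 id}.
Proof.
by move=> f; rewrite inE /= /ps_invr => /negPf; rewrite /in_mem /= => ->.
Qed.

HB.instance Definition _ := GRing.ComNzRing_hasMulInverse.Build (ps F)
  ps_mulVf ps_unitP ps_invr_out.

Lemma ps_unitE f : (f \is a GRing.unit) = (f 0%N != 0).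
Proof. by []. Qed.

Lemma ps_invE f : f 0%N != 0 -> ps_inv f = f^-1.
Proof. by move=> f0; rewrite [RHS]/(ps_invr f) /ps_invr [ps_unit f]f0. Qed.

End PowerSeriesCoefficients.

(** * q-Pochhammer symbols and the two forms of the partition series *)

Section QPochhammer.
Variable F : fieldType.
Implicit Types (f g h a : ps F) (c : F) (i j k m n : nat).
Local Notation q := (ps_q F).

(** Congruence modulo q^m, which measures how far a series built from finitely many modes is
    exact. *)
Definition ps_eqmod m f g := forall i, (i < m)%N -> f i = g i.

Lemma ps_eqmod_addXn m f r : ps_eqmod m (f + q ^+ m * r) f.
Proof. by move=> i lt_im; rewrite ps_addE ps_mulXn lt_im addr0. Qed.

Lemma ps_eqmodM m f f' g g' : ps_eqmod m f f' -> ps_eqmod m g g' ->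
  ps_eqmod m (f * g) (f' * g').
Proof.
move=> eqf eqg i lt_im; rewrite !ps_mulE; apply: eq_bigr => j _.
have lt_jm : (j < m)%N by apply: leq_ltn_trans lt_im; rewrite -ltnS.
by rewrite eqf ?eqg // (leq_ltn_trans (leq_subr _ _)).
Qed.

Lemma ps_prodE (s : seq (ps F)) : ps_prod s = \prod_(f <- s) f.
Proof. by rewrite unlock. Qed.

Lemma qpochE a n : qpoch a n = \prod_(j < n) (1 - a * q ^+ j).
Proof.
rewrite /qpoch ps_prodE big_map -[X in iota 0 X]subn0 -/(index_iota 0 n).
rewrite big_mkord.
by apply: eq_bigr => j _; rewrite ps_subE ps_XnE.
Qed.

Lemma qpoch0 a : qpoch a 0 = 1.
Proof. by []. Qed.

Lemma qpochS a n : qpoch a n.+1 = qpoch a n * (1 - a * q ^+ n).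
Proof. by rewrite !qpochE big_ord_recr. Qed.

Lemma qpoch_qS n : qpoch q n.+1 = qpoch q n * (1 - q ^+ n.+1).
Proof. by rewrite qpochS -exprS. Qed.

Lemma qpochD a m n : qpoch a (m + n) = qpoch a m * qpoch (a * q ^+ m) n.
Proof.
elim: n => [|n IHn]; first by rewrite addn0 qpoch0 mulr1.
by rewrite addnS !qpochS IHn -!mulrA -exprD.
Qed.

Lemma qpoch_zero n : qpoch (0 : ps F) n = 1.
Proof. by rewrite qpochE big1 // => i _; rewrite mul0r subr0. Qed.

Lemma unit_1BMq f k : (1 - f * q ^+ k.+1) \is a GRing.unit.
Proof.
rewrite ps_unitE ps_addE ps_oppE mulrC ps_mulXn /= oppr0 addr0.
exact: oner_neq0.
Qed.

Lemma unit_qpoch f k n : qpoch (f * q ^+ k.+1) n \is a GRing.unit.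
Proof.
rewrite qpochE; apply: rpred_prod => j _; rewrite -mulrA -exprD addSn.
exact: unit_1BMq.
Qed.

Lemma unit_qpoch_q n : qpoch q n \is a GRing.unit.
Proof.
by rewrite -[q in X in qpoch X]mul1r -[q in X in qpoch X]expr1 unit_qpoch.
Qed.

Hint Resolve unit_1BMq unit_qpoch unit_qpoch_q : core.

Lemma qpoch_qD m n : qpoch q (m + n) = qpoch q m * qpoch (q ^+ m.+1) n.
Proof. by rewrite qpochD -exprS. Qed.

(** Telescoping: 1 / (q)_(n+1) - 1 / (q)_n = q^(n+1) / (q)_(n+1). *)
Lemma sum_q_qpoch n : \sum_(k < n.+1) q ^+ k / qpoch q k = (qpoch q n)^-1.
Proof.
elim: n => [|n IHn]; first by rewrite big_ord1 qpoch0 divr1 invr1 expr0.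
have := unit_qpoch_q n.+1; rewrite qpoch_qS unitrM => /andP[uq u1q].
rewrite big_ord_recr IHn /= qpoch_qS invrM //.
rewrite -[in X in X + _](mul1r (qpoch q n)^-1) -{1}(mulVr u1q); ring.
Qed.

(* The summand [b] marks the part in position [b + 1]: in the conjugate       *)
(* partition the parts [<= b] do not reach it, hence carry no factor [c].     *)
Definition part_gf c n : ps F :=
  \sum_(b < n) (qpoch q b * qpoch (ps_C c * q ^+ b.+1) (n - b))^-1.

(** For every b the last factor of (c q^(b+1))_(n+1-b) is 1 - c q^(n+1), so multiplying cancels it;
    the summand b = n becomes 1 / (q)_n. *)
Lemma part_gfS c n :
  (1 - ps_C c * q ^+ n.+1) * part_gf c n.+1 = part_gf c n + (qpoch q n)^-1.
Proof.
rewrite /part_gf big_ord_recr /= subSnn qpochS qpoch0 mul1r expr0 mulr1 mulrDr.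
congr (_ + _); last by rewrite invrM // mulVKr.
rewrite mulr_sumr; apply: eq_bigr => b _; have /ltnW le_bn := ltn_ord b.
rewrite subSn // qpochS -mulrA -exprD addSn subnKC // [_ * (_ * _)]mulrA.
by rewrite [in LHS]invrM ?unitrM ?unit_qpoch_q ?unit_qpoch // mulVKr.
Qed.

Lemma part_gf_multiplicity c n :
  \sum_(l < n) (1 - ps_C c * q ^+ l.+1)^-1 / qpoch q (n - l.+1) = part_gf c n.
Proof.
elim: n => [|n IHn]; first by rewrite /part_gf !big_ord0.
apply: (mulrI (unit_1BMq (ps_C c) n)); rewrite part_gfS -IHn -sum_q_qpoch.
rewrite [X in _ = _ + X](reindex_inj rev_ord_inj) /= mulr_sumr.
(* The added term l = n vanishes through 1 - q^0, and both sums now have the same range and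
   denominators (q)_(n-l). *)
rewrite [X in _ = X + _](_ : _ = \sum_(l < n.+1)
    (1 - q ^+ (n - l)) / (1 - ps_C c * q ^+ l.+1) / qpoch q (n - l));
    last first.
  rewrite big_ord_recr /= subnn expr0 subrr !mul0r addr0.
  apply: eq_bigr => l _; rewrite -(subnSK (ltn_ord l)).
  have := unit_qpoch_q (n - l.+1).+1; rewrite qpoch_qS unitrM => /andP[uq u1q].
  by rewrite invrM // mulrA; congr (_ / _); rewrite mulrAC mulrV // mul1r.
rewrite -big_split /=; apply: eq_bigr => l _; rewrite subSS.
have le_ln : (l <= n)%N by rewrite -ltnS.
rewrite mulrA -mulrDl; congr (_ / _).
rewrite -[X in _ = _ + X](mulrK (unit_1BMq (ps_C c) l)) -mulrDl.
(* With q^(n+1) = q^(n-l) q^(l+1), this is (1 - q^(n-l)) + q^(n-l) (1 - c q^(l+1)) = 1 - c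
   q^(n+1). *)
congr (_ / _); rewrite -{1}(subnK le_ln) -addnS exprD; ring.
Qed.

Lemma geometric_eqmod c l m :
  ps_eqmod m (\sum_(k < m) (ps_C c * q ^+ l.+1) ^+ k)
             (1 - ps_C c * q ^+ l.+1)^-1.
Proof.
have u := unit_1BMq (ps_C c) l.
(* The remainder contains (c q^(l+1))^m = q^m (c q^l)^m, which exhibits the factor q^m. *)
have -> : \sum_(k < m) (ps_C c * q ^+ l.+1) ^+ k = (1 - ps_C c * q ^+ l.+1)^-1 +
    q ^+ m * (- (ps_C c * q ^+ l) ^+ m / (1 - ps_C c * q ^+ l.+1)).
  apply: (mulrI u); rewrite mulrDr mulrV //.
  rewrite -[X in X * _]opprB mulNr -subrX1 opprB; congr (_ + _).
  rewrite [RHS](_ : _ = - (q ^+ m * (ps_C c * q ^+ l) ^+ m) *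
    ((1 - ps_C c * q ^+ l.+1) / (1 - ps_C c * q ^+ l.+1))); last by ring.
  by rewrite mulrV // mulr1 -exprMn mulrCA -exprS.
exact: ps_eqmod_addXn.
Qed.

Lemma qpoch_eqmod k n : ps_eqmod k (qpoch (q ^+ k) n) 1.
Proof.
elim: n => [|n IHn]; first by rewrite qpoch0.
rewrite qpochS -[X in ps_eqmod _ _ X]mulr1; apply: ps_eqmodM IHn _.
by rewrite -mulrN; exact: ps_eqmod_addXn.
Qed.

End QPochhammer.

(** * Generating functions of multiplicity functions *)

Lemma coefM_eql (R : nzRingType) (p p' r : {poly R}) a :
  (forall i, (i <= a)%N -> p`_i = p'`_i) -> (p * r)`_a = (p' * r)`_a.
Proof.
by move=> eqp; rewrite !coefM; apply: eq_bigr => i _; rewrite eqp // -ltnS.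
Qed.

Lemma prod_sum_scaleX (R : comNzRingType) (K J : nat) (u : 'I_K -> 'I_J -> R) :
  \prod_(k < K) \sum_(j < J) u k j *: 'X^j =
  \sum_(m : {ffun 'I_K -> 'I_J}) (\prod_k u k (m k)) *: 'X^(\sum_k m k).
Proof.
rewrite bigA_distr_bigA; apply: eq_bigr => m _.
by rewrite scaler_prod -prodrXr.
Qed.

Lemma coef_prod_sum_scaleX (R : comNzRingType) (K J : nat)
    (u : 'I_K -> 'I_J -> R) a :
  (\prod_(k < K) \sum_(j < J) u k j *: 'X^j)`_a =
  \sum_(m : {ffun 'I_K -> 'I_J} | (\sum_k m k == a)%N) \prod_k u k (m k).
Proof.
rewrite prod_sum_scaleX coef_sum [RHS]big_mkcond; apply: eq_bigr => m _.
by rewrite coefZ coefXn eq_sym; case: eqP; rewrite ?mulr1 ?mulr0.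
Qed.

Section Multiplicities.
Variables (F : fieldType) (J : nat).
Local Notation q := (ps_q F).
Implicit Types (a k K : nat) (c : F).

(** The polynomial variable counts parts. Stopping at degree [J] mirrors the bounded multiplicities
    of [mult] and is invisible in degrees at most [J]. *)
Definition mode_gf k : {poly ps F} := \poly_(j < J.+1) q ^+ (k * j).
Definition modes_gf K : {poly ps F} := \prod_(k < K) mode_gf k.

Lemma modes_gf_coef0 K : (modes_gf K)`_0 = 1.
Proof.
elim: K => [|K IHK]; first by rewrite /modes_gf big_ord0 coef1.
rewrite /modes_gf big_ord_recr coef0M -/(modes_gf K) IHK.
by rewrite mul1r coef_poly muln0.
Qed.

(** A Pascal rule: among a + 1 parts of size at most K, either none equals K or one such part can be
    removed. *)
Lemma modes_gf_recr K a : (a < J)%N ->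
  (modes_gf K.+1)`_a.+1 = (modes_gf K)`_a.+1 + q ^+ K * (modes_gf K.+1)`_a.
Proof.
move=> lt_aJ; rewrite /modes_gf big_ord_recr /= -/(modes_gf K) !coefMr.
rewrite big_ord_recl subn0 coef_poly muln0 mulr1; congr (_ + _).
rewrite mulr_sumr; apply: eq_bigr => j _; rewrite subSS !coef_poly.
have lt_jJ : (j < J)%N by apply: leq_ltn_trans lt_aJ; rewrite -ltnS.
by rewrite ltnS lt_jJ ltnS (ltnW lt_jJ) mulnS exprD mulrCA.
Qed.

(** The coefficient is the Gaussian binomial K + a over a, by double induction on the Pascal
    rule. *)
Lemma modes_gf_qbinomial K a : (a <= J)%N ->
  (modes_gf K.+1)`_a * qpoch q a = qpoch (q ^+ K.+1) a.
Proof.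
elim: K a => [|K IHK] a.
  move=> le_aJ; rewrite /modes_gf big_ord1 coef_poly ltnS le_aJ mul0n mul1r.
  by rewrite expr1.
elim: a => [|a IHa] le_aJ; first by rewrite modes_gf_coef0 !qpoch0 mulr1.
rewrite modes_gf_recr // mulrDl IHK // -mulrA qpoch_qS.
rewrite [(modes_gf _)`_a * _]mulrA IHa 1?ltnW //.
have -> : qpoch (q ^+ K.+1) a.+1 = (1 - q ^+ K.+1) * qpoch (q ^+ K.+2) a.
  by rewrite -[a.+1]add1n qpochD qpochS qpoch0 mul1r expr0 mulr1 -exprSr.
by rewrite qpochS -exprD addSnnS [q ^+ (_ + _)]exprD; ring.
Qed.

Lemma modes_gf_eqmod K a : (a <= J)%N ->
  ps_eqmod K (modes_gf K)`_a (qpoch q a)^-1.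
Proof.
case: K => [|K] le_aJ; first by move=> i; rewrite ltn0.
rewrite -[X in ps_eqmod _ X _](mulrK (unit_qpoch_q F a)) modes_gf_qbinomial //.
rewrite -[X in ps_eqmod _ _ X]mul1r; apply: ps_eqmodM => //.
exact: qpoch_eqmod.
Qed.

Definition mult_weight K (m : {ffun 'I_K -> 'I_J.+1}) : nat :=
  \sum_(k < K) k * m k.

Lemma sum_mult_weight K a :
  \sum_(m : {ffun 'I_K -> 'I_J.+1} | (\sum_k m k == a)%N) q ^+ mult_weight m
  = (modes_gf K)`_a.
Proof.
rewrite /modes_gf; under [in RHS]eq_bigr do rewrite /mode_gf poly_def.
rewrite (coef_prod_sum_scaleX (fun (k : 'I_K) (j : 'I_J.+1) => q ^+ (k * j))).
by apply: eq_bigr => m _; rewrite prodrXr.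
Qed.

(* With y counting the parts, the weight [m k = #{1 <= l <= m k}] multiplies  *)
(* the series of mode [k] by [sum_(l >= 1) (q^k y)^l].                        *)
Lemma sum_mult_weight_mode K (k : 'I_K) a : (a <= J)%N ->
  \sum_(m : {ffun 'I_K -> 'I_J.+1} | (\sum_k m k == a)%N)
    (m k)%:R * q ^+ mult_weight m
  = \sum_(l < a) q ^+ (k * l.+1) * (modes_gf K)`_(a - l.+1).
Proof.
move=> le_aJ.
pose u (i : 'I_K) (j : 'I_J.+1) : ps F :=
  (if i == k then (j : nat)%:R else 1) * q ^+ (i * j).
pose D : {poly ps F} := \poly_(j < J.+1) (j%:R * q ^+ (k * j)).
pose L : {poly ps F} := \poly_(j < J.+1) (if j == 0%N then 0 else q ^+ (k * j)).
transitivity ((\prod_(i < K) \sum_(j < J.+1) u i j *: 'X^j)`_a).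
  rewrite coef_prod_sum_scaleX; apply: eq_bigr => m _.
  by rewrite big_split prodrXr -big_mkcond big_pred1_eq.
rewrite (bigD1 k) //= [X in X * _](_ : _ = D); last first.
  by rewrite /D poly_def; apply: eq_bigr => j _; rewrite /u eqxx.
(* [D] and the product agree only up to degree [J], which is enough since a <= J. *)
rewrite (coefM_eql (p' := L * mode_gf k)) => [|i le_ia]; last first.
  have le_iJ := leq_trans le_ia le_aJ.
  rewrite coef_poly ltnS le_iJ coefM big_ord_recl coef_poly mul0r add0r.
  rewrite mulr_natl [LHS](_ : _ = \sum_(j < i) q ^+ (k * i)); last first.
    by rewrite sumr_const card_ord.
  apply: eq_bigr => j _.
  have lt_jJ : (j < J)%N := leq_trans (ltn_ord j) le_iJ.
  rewrite !coef_poly /= ltnS lt_jJ ltnS (leq_trans (leq_subr _ _)) //.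
  by rewrite -exprD -mulnDr subnKC // ltn_ord.
rewrite -mulrA [X in (L * X)`_a](_ : _ = modes_gf K); last first.
  apply/esym; rewrite /modes_gf (bigD1 k) //=; congr (_ * _).
  apply: eq_bigr => i /negPf neq_ik.
  by rewrite /mode_gf poly_def; apply: eq_bigr => j _; rewrite /u neq_ik mul1r.
rewrite coefM big_ord_recl coef_poly mul0r add0r; apply: eq_bigr => l _.
by rewrite coef_poly ltnS (leq_trans (ltn_ord l) le_aJ).
Qed.

(** Summing [sum_mult_weight_mode] against c^k and exchanging sums turns the sum over modes into a
    truncated geometric series in c q^(l+1). *)
Lemma sum_mult_weight_geometric K a c : (a <= J)%N ->
  \sum_(m : {ffun 'I_K -> 'I_J.+1} | (\sum_k m k == a)%N)
    ps_C (\sum_(k < K) (m k)%:R * c ^+ k) * q ^+ mult_weight m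
  = \sum_(l < a)
      (\sum_(k < K) (ps_C c * q ^+ l.+1) ^+ k) * (modes_gf K)`_(a - l.+1).
Proof.
move=> le_aJ; transitivity (\sum_(k < K) ps_C c ^+ k *
    \sum_(l < a) q ^+ (k * l.+1) * (modes_gf K)`_(a - l.+1)).
  transitivity (\sum_(k < K) ps_C c ^+ k *
     \sum_(m : {ffun 'I_K -> 'I_J.+1} | (\sum_k m k == a)%N)
       (m k)%:R * q ^+ mult_weight m); last first.
    by apply: eq_bigr => k _; rewrite sum_mult_weight_mode.
  under [RHS]eq_bigr do rewrite mulr_sumr.
  rewrite exchange_big; apply: eq_bigr => m _ /=.
  rewrite rmorph_sum mulr_suml; apply: eq_bigr => k _.
  by rewrite rmorphM rmorph_nat rmorphXn /=; ring.
under eq_bigr do rewrite mulr_sumr.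
rewrite exchange_big; apply: eq_bigr => l _ /=.
rewrite mulr_suml; apply: eq_bigr => k _.
by rewrite exprMn -exprM mulrA mulnC.
Qed.

(* With [K] modes only the coefficients below [q^K] are right, except for the *)
(* vacuum [a = 0].                                                            *)
Lemma modes_gf_coef K a i : (a <= J)%N -> (i < K)%N || (a == 0%N) ->
  (modes_gf K)`_a i = (qpoch q a)^-1 i.
Proof.
move=> le_aJ /orP[lt_iK | /eqP->]; first exact: modes_gf_eqmod lt_iK.
by rewrite modes_gf_coef0 qpoch0 invr1.
Qed.

Lemma sum_mult_weight_coef K a c i : (a <= J)%N -> (i < K)%N || (a == 0%N) ->
  (\sum_(m : {ffun 'I_K -> 'I_J.+1} | (\sum_k m k == a)%N)
     ps_C (\sum_(k < K) (m k)%:R * c ^+ k) * q ^+ mult_weight m) i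
  = part_gf c a i.
Proof.
move=> le_aJ; rewrite sum_mult_weight_geometric // -part_gf_multiplicity.
case/orP=> [lt_iK | /eqP->]; last by rewrite !big_ord0.
rewrite !ps_sum_coefE; apply: eq_bigr => l _; move: i lt_iK.
apply: ps_eqmodM; first exact: geometric_eqmod.
by apply: modes_gf_eqmod; rewrite (leq_trans (leq_subr _ _)).
Qed.
End Multiplicities.

(** * The hypergeometric side *)

Section Hypergeometric.
Variable F : fieldType.
Local Notation q := (ps_q F).
Implicit Types (f g : ps F) (c : F) (b n N : nat).

Lemma ps_mul_mulr f g : ps_mul f g = f * g. Proof. by []. Qed.

Lemma qPhi_00_q : qPhi [:: ps_zero F; ps_zero F] [:: q] q =
  ps_sum (fun n => q ^+ n * (qpoch q n * qpoch q n)^-1).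
Proof.
congr ps_sum; apply/funext => n; rewrite /= !ps_mul_mulr !ps_powE.
rewrite -[ps_zero F]/(0 : ps F) qpoch_zero -[ps_one F]/(1 : ps F) !mul1r mulr1.
rewrite ps_invE; last by rewrite -ps_unitE unitrM !unit_qpoch_q.
by rewrite mulrC.
Qed.

(** The upper parameter q cancels the built-in (q)_n, and the sign factor has exponent 0. *)
Lemma qPhi_00q c b :
  qPhi [:: ps_zero F; ps_zero F; q]
       [:: ps_scale c (ps_Xn F b.+1); ps_Xn F b.+1] q =
  ps_sum (fun n =>
    q ^+ n * (qpoch (ps_C c * q ^+ b.+1) n * qpoch (q ^+ b.+1) n)^-1).
Proof.
congr ps_sum; apply/funext => n; rewrite /= !ps_mul_mulr !ps_powE.
rewrite -[ps_zero F]/(0 : ps F) qpoch_zero -[ps_one F]/(1 : ps F) !mul1r !mulr1.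
rewrite ps_scaleE !ps_XnE.
have u1 := unit_qpoch (ps_C c) b n.
have u2 : qpoch (q ^+ b.+1) n \is a GRing.unit.
  by rewrite -[q ^+ _]mul1r unit_qpoch.
rewrite ps_invE; last by rewrite -ps_unitE !unitrM u1 u2 unit_qpoch_q.
rewrite [LHS]mulrC; congr (_ * _).
by rewrite invrM ?unitrM ?u1 ?u2 ?unit_qpoch_q // mulVKr ?unit_qpoch_q.
Qed.

Lemma ps_sum_eqmod (T : nat -> ps F) N :
  ps_eqmod N (ps_sum (fun n => q ^+ n * T n)) (\sum_(n < N) q ^+ n * T n).
Proof.
move=> i lt_iN; rewrite ps_sum_coefE /ps_sum.
rewrite (big_ord_widen N (fun n => (q ^+ n * T n) i)) // big_mkcond /=.
apply: eq_bigr => n _; case: ifP => //; rewrite ltnS leqNgt => /negbFE lt_in.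
by rewrite ps_mulXn lt_in.
Qed.

(** Reindexing by a = b + n + 1; the part of the rectangle beyond a = N is zero. *)
Lemma sum_triangle (V : nmodType) (G : nat -> nat -> V) N :
  (forall b n, (N < b + n)%N -> G b n = 0) ->
  \sum_(b < N.+1) \sum_(n < N) G b n.+1 =
  \sum_(a < N.+1) \sum_(b < a) G b (a - b)%N.
Proof.
move=> G0; rewrite [RHS](_ : _ =
    \sum_(a < N.+1) \sum_(b < N.+1 | (b < a)%N) G b (a - b)%N); last first.
  apply: eq_bigr => a _.
  by rewrite (big_ord_widen N.+1 (fun b => G b (a - b)%N)) // ltnW.
rewrite [RHS](exchange_big_dep xpredT) //=; apply: eq_bigr => b _.
have le_bN : (b <= N)%N by rewrite -ltnS.
rewrite -(big_geq_mkord b.+1 N.+1 xpredT (fun a => G b (a - b)%N)).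
rewrite -[b.+1 in RHS]add0n big_addn subSS.
rewrite -(big_mkord xpredT (fun n => G b n.+1)).
rewrite [LHS](@big_cat_nat _ _ _ (N - b)) ?leq_subr //=.
rewrite [X in _ + X]big_nat_cond [X in _ + X]big1 ?addr0.
  by apply: eq_bigr => n _; rewrite addnS subSn ?leq_addl // addnK.
by move=> n /andP[/andP[le_n _] _]; rewrite G0 // addnS ltnS -leq_subLR.
Qed.

Definition rhs_inner c : ps F :=
  ps_sum (fun n =>
    let i := n.+1 in
    ps_mul (ps_mul (ps_Xn F (i - 1))
                   (ps_inv (ps_mul (qpoch q (i - 1)) (qpoch q (i - 1)))))
           (ps_sub (qPhi [:: ps_zero F; ps_zero F; q]
                         [:: ps_scale c (ps_Xn F i); ps_Xn F i] q)
                   (ps_one F))).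

Lemma rhs_inner_coef c N :
  rhs_inner c N = \sum_(a < N.+1) (q ^+ a * ((qpoch q a)^-1 * part_gf c a)) N.
Proof.
pose G b n := (q ^+ (b + n) * ((qpoch q (b + n))^-1 *
  (qpoch q b * qpoch (ps_C c * q ^+ b.+1) n)^-1)) N.
transitivity (\sum_(b < N.+1) \sum_(n < N) G b n.+1); last first.
  rewrite sum_triangle => [|b n lt_N]; last by rewrite /G ps_mulXn lt_N.
  apply: eq_bigr => a _; rewrite /part_gf !mulr_sumr ps_sum_coefE.
  by apply: eq_bigr => b _; rewrite /G subnKC // ltnW.
rewrite /rhs_inner /ps_sum; apply: eq_bigr => b _.
rewrite /= !ps_mul_mulr ps_subE qPhi_00q -[ps_one F]/(1 : ps F).
rewrite subSS subn0 ps_XnE.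
rewrite ps_invE; last by rewrite -ps_unitE unitrM !unit_qpoch_q.
pose T n := q ^+ n * (qpoch (ps_C c * q ^+ b.+1) n * qpoch (q ^+ b.+1) n)^-1.
transitivity ((q ^+ b / (qpoch q b * qpoch q b) * \sum_(n < N) T n.+1) N).
  (* The subtracted 1 is the n = 0 term of the series, hence the shift to [T n.+1]. *)
  apply: (@ps_eqmodM _ N.+1) => // i lt_iN; rewrite ps_addE ps_oppE.
  rewrite (ps_sum_eqmod _ lt_iN) big_ord_recl !qpoch0 expr0 mulr1 invr1 mulr1.
  by rewrite ps_addE addrC addKr.
rewrite mulr_sumr ps_sum_coefE; apply: eq_bigr => n _; rewrite /G /T exprD.
apply: (congr1 (fun f : ps F => f N)); rewrite qpoch_qD.
have : qpoch (q ^+ b.+1) n.+1 \is a GRing.unit.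
  by rewrite -[q ^+ _]mul1r unit_qpoch.
move: (unit_qpoch_q F b) (unit_qpoch (ps_C c) b n.+1).
move: (qpoch q b) (qpoch _ n.+1) (qpoch _ n.+1) => f g h uf ug uh.
by rewrite !invrM //; ring.
Qed.

Lemma theorem2p4_rhs_coef (x : F) N :
  theorem2p4_rhs x N = \sum_(a < N.+1)
    (q ^+ a * (ps_C x * (part_gf (x ^+ 2) a / qpoch q a)
             - ps_C x^-1 * (part_gf (x ^+ 2)^-1 a / qpoch q a)
             + ps_C (x^-1 - x)^-1 * ((qpoch q a)^-1 * (qpoch q a)^-1))) N.
Proof.
rewrite [LHS](_ : _ = (x^-1 - x)^-1 * qPhi [:: ps_zero F; ps_zero F] [:: q] q N
  + x * rhs_inner (x ^+ 2) N + - x^-1 * rhs_inner (x ^+ 2)^-1 N) //.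
rewrite qPhi_00_q !rhs_inner_coef /ps_sum !mulr_sumr -!big_split /=.
apply: eq_bigr => a _; rewrite -![_ * (_ : ps F) N]/(ps_scale _ _ N) !ps_scaleE.
rewrite -!ps_addE rmorphN invrM ?unit_qpoch_q //.
by apply: (congr1 (fun f : ps F => f N)); ring.
Qed.
End Hypergeometric.

(** * The trace side *)

Section Trace.
Variable F : fieldType.
Local Notation q := (ps_q F).
Implicit Types (x : F) (N : nat).

Lemma fock_dweightE N (m : mult N) :
  fock_dweight m = (2 * mult_weight m + fock_count m)%N.
Proof.
rewrite /fock_dweight /mult_weight /fock_count big_distrr -big_split /=.
by apply: eq_bigr => k _; rewrite mulnDl mul1n mulnA.
Qed.

Definition multiplicity_sum x N (m : mult N) : F :=
  \sum_(k < N) (m k : nat)%:R * x ^+ k.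

Lemma A_eigenE x N (mp mm : mult N) :
  A_eigen x mp mm = x * multiplicity_sum (x ^+ 2) mp
    - x^-1 * multiplicity_sum (x ^+ 2)^-1 mm + (x^-1 - x)^-1.
Proof.
congr (_ - _ + _); rewrite mulr_sumr; apply: eq_bigr => k _.
  by rewrite addn1 exprS exprM mulrCA.
by rewrite addn1 exprS exprM invfM -exprVn mulrCA.
Qed.

(** Both trace constraints become the extraction of one coefficient, so that the sums over [mp] and
    [mm] can factor for each fixed number a of pairs. *)
Lemma trace_summandE N (A : F) (mp mm : mult N) :
  (if (fock_count mp == fock_count mm)
        && (fock_dweight mp + fock_dweight mm == 2 * N)%N then A else 0) =
  \sum_(a < N.+1 | (fock_count mp == a) && (fock_count mm == a))
    (q ^+ a * (ps_C A * (q ^+ mult_weight mp * q ^+ mult_weight mm))) N.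
Proof.
have [eq_c | neq_c] /= := eqVneq (fock_count mp) (fock_count mm); last first.
  rewrite big_pred0 // => a; apply/negbTE; apply: contra neq_c.
  by case/andP=> /eqP-> /eqP->.
rewrite !fock_dweightE -eq_c; set c := fock_count mp.
have -> : (2 * mult_weight mp + c + (2 * mult_weight mm + c) == 2 * N)%N =
          (N == c + (mult_weight mp + mult_weight mm))%N by lia.
have coefE (a : nat) :
    (q ^+ a * (ps_C A * (q ^+ mult_weight mp * q ^+ mult_weight mm))) N =
    if (N == a + (mult_weight mp + mult_weight mm))%N then A else 0.
  rewrite mulrCA -!exprD -ps_scaleE -ps_XnE /ps_scale /ps_Xn.
  by case: ifP; rewrite ?mulr1 ?mulr0.
have [lt_cN | le_Nc] := ltnP c N.+1.
  rewrite (big_pred1 (Ordinal lt_cN)) ?coefE // => a.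
  by rewrite andbb eq_sym.
(* More than N pairs already exceed weight N, so both sides are 0. *)
rewrite big_pred0 => [|a]; first by case: eqP => //; lia.
by rewrite andbb gtn_eqF // (leq_trans (ltn_ord a)).
Qed.

Lemma trace_A_coef x N : trace_A x N = \sum_(a < N.+1)
  (q ^+ a * (ps_C x * (part_gf (x ^+ 2) a / qpoch q a)
           - ps_C x^-1 * (part_gf (x ^+ 2)^-1 a / qpoch q a)
           + ps_C (x^-1 - x)^-1 * ((qpoch q a)^-1 * (qpoch q a)^-1))) N.
Proof.
rewrite /trace_A /trace_A_coeff.
under eq_bigr do (under eq_bigr do rewrite trace_summandE).
under eq_bigr do rewrite (exchange_big_dep xpredT) //=.
rewrite exchange_big; apply: eq_bigr => a _ /=.
have le_aN : (a <= N)%N by rewrite -ltnS.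
have le_aJ : (a <= 2 * N)%N by rewrite mul2n -addnn (leq_trans le_aN) ?leq_addr.
pose Z : ps F := \sum_(m : mult N | fock_count m == a) q ^+ mult_weight m.
pose W c : ps F :=
  \sum_(m : mult N | fock_count m == a)
    ps_C (multiplicity_sum c m) * q ^+ mult_weight m.
transitivity ((q ^+ a * (ps_C x * (W (x ^+ 2) * Z)
    - ps_C x^-1 * (W (x ^+ 2)^-1 * Z) + ps_C (x^-1 - x)^-1 * (Z * Z))) N).
  rewrite [X in q ^+ a * X](_ : _ =
    \sum_(mp : mult N | fock_count mp == a)
    \sum_(mm : mult N | fock_count mm == a)
      ps_C (A_eigen x mp mm) * (q ^+ mult_weight mp * q ^+ mult_weight mm)).
    rewrite mulr_sumr ps_sum_coefE [RHS]big_mkcond; apply: eq_bigr => mp _.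
    case: ifP => _; last by rewrite big_pred0.
    by rewrite mulr_sumr ps_sum_coefE.
  (* Here the marked partition is [mm], so its factor must come second for the outer sums to run
     over [mp] in all three products. *)
  rewrite [W (x ^+ 2)^-1 * Z]mulrC !big_distrlr !mulr_sumr.
  rewrite -sumrB -big_split; apply: eq_bigr => mp _ /=.
  rewrite !mulr_sumr -sumrB -big_split; apply: eq_bigr => mm _ /=.
  by rewrite A_eigenE rmorphD rmorphB !rmorphM /=; ring.
have coefZ i : (i <= N - a)%N -> Z i = (qpoch q a)^-1 i.
  move=> le_i; rewrite /Z sum_mult_weight modes_gf_coef //.
  by lia.
have coefW c i : (i <= N - a)%N -> W c i = part_gf c a i.
  move=> le_i; rewrite /W sum_mult_weight_coef //.
  by lia.
(* Only coefficients up to N - a remain; they lie below the number N of modes unless a = 0, where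
   the truncated series are exact. *)
rewrite !ps_mulXn ltnNge le_aN /=.
have eqZ : ps_eqmod (N - a).+1 Z (qpoch q a)^-1 by move=> i; apply: coefZ.
have eqW c : ps_eqmod (N - a).+1 (W c) (part_gf c a) by move=> i; apply: coefW.
have eqC c f g : ps_eqmod (N - a).+1 f g ->
    (ps_C c * f) (N - a)%N = (ps_C c * g) (N - a)%N.
  by move=> eqfg; apply: (@ps_eqmodM _ (N - a).+1).
rewrite !ps_addE !ps_oppE; congr (_ - _ + _); apply: eqC; exact: ps_eqmodM.
Qed.
End Trace.

Theorem theorem2p4 (F : fieldType) (x : F) (hx0 : x != 0) (hx1 : x ^+ 2 != 1) :
  forall N : nat, trace_A x N = theorem2p4_rhs x N.
Proof. by move=> N; rewrite trace_A_coef theorem2p4_rhs_coef. Qed.
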